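(* Classical linear logic with connectives $(-)^\bot,\otimes,\wp,\mathbf{1},\bot,\multimap,\&,\oplus$ is conservative over intuitionistic linear logic with connectives $\otimes,\mathbf{1},\multimap,\&,\oplus$ (but not $\mathbf{0},\top$). That is, if $A_1,\dots,A_n,B$ are formulas built from atoms using only $\otimes,\mathbf{1},\multimap,\&,\oplus$, and the sequent $A_1,\dots,A_n\vdash B$ is derivable in the classical system, then it is derivable in the intuitionistic system.
   Context: The classical system has sequents $\Gamma\vdash\Delta$ with $\Gamma,\Delta$ finite lists of formulas, and the rules: exchange on both sides; identity $A\vdash A$; cut (from $\Gamma\vdash\Delta,A$ and $\Gamma',A\vdash\Delta'$ infer $\Gamma,\Gamma'\vdash\Delta,\Delta'$); $\otimes$ (from $\Gamma,A,B\vdash\Delta$ infer $\Gamma,A\otimes B\vdash\Delta$; from $\Gamma\vdash\Delta,A$ and $\Gamma'\vdash\Delta',B$ infer $\Gamma,\Gamma'\vdash\Delta,\Delta',A\otimes B$); $\mathbf{1}$ (from $\Gamma\vdash\Delta$ infer $\Gamma,\mathbf{1}\vdash\Delta$; axiom $\vdash\mathbf{1}$); $\wp$ and $\bot$ (the duals of the rules for $\otimes$ and $\mathbf{1}$, exchanging left and right); negation (from $\Gamma\vdash\Delta,A$ infer $\Gamma,A^\bot\vdash\Delta$; from $\Gamma,A\vdash\Delta$ infer $\Gamma\vdash\Delta,A^\bot$); $\multimap$ (from $\Gamma\vdash\Delta,A$ and $\Gamma',B\vdash\Delta'$ infer $\Gamma,\Gamma',A\multimap B\vdash\Delta,\Delta'$;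 from $\Gamma,A\vdash\Delta,B$ infer $\Gamma\vdash\Delta,A\multimap B$); $\&$ (from $\Gamma,A\vdash\Delta$ or $\Gamma,B\vdash\Delta$ infer $\Gamma,A\& B\vdash\Delta$; from $\Gamma\vdash\Delta,A$ and $\Gamma\vdash\Delta,B$ infer $\Gamma\vdash\Delta,A\& B$); $\oplus$ (dual to $\&$). The intuitionistic system uses only the connectives $\otimes,\mathbf{1},\multimap,\&,\oplus$ and the same rules for them (with identity, exchange and cut), restricted so that every sequent in a derivation has exactly one formula on the right. Neither system has weakening, contraction, exponentials, or the additive units $\mathbf{0},\top$. *)

(* Defs.v *)
From Stdlib Require Export List.
Export ListNotations.

Set Implicit Arguments.

Inductive cform (At : Type) : Type :=
| CAtom (a : At)
| CNeg (A : cform At)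
| CTensor (A B : cform At)
| CPar (A B : cform At)
| COne
| CBot
| CLolli (A B : cform At)
| CWith (A B : cform At)
| CPlus (A B : cform At).

Arguments COne {At}.
Arguments CBot {At}.

Inductive iform (At : Type) : Type :=
| IAtom (a : At)
| ITensor (A B : iform At)
| IOne
| ILolli (A B : iform At)
| IWith (A B : iform At)
| IPlus (A B : iform At).

Arguments IOne {At}.

Fixpoint embed (At : Type) (A : iform At) : cform At :=
  match A with
  | IAtom a => CAtom a
  | ITensor A B => CTensor (embed A) (embed B)
  | IOne => COne
  | ILolli A B => CLolli (embed A) (embed B)
  | IWith A B => CWith (embed A) (embed B)
  | IPlus A B => CPlus (embed A) (embed B)
  end.

(* Contexts are lists with explicit adjacent exchange; the active formula of a
   rule is the last one of its list. *)

Reserved Notation "G |-c D" (at level 70, no associativity).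

Inductive cderiv (At : Type) : list (cform At) -> list (cform At) -> Prop :=
| c_exchange_l G G' D A B :
    G ++ [A; B] ++ G' |-c D -> G ++ [B; A] ++ G' |-c D
| c_exchange_r G D D' A B :
    G |-c D ++ [A; B] ++ D' -> G |-c D ++ [B; A] ++ D'
| c_id A :
    [A] |-c [A]
| c_cut G G' D D' A :
    G |-c D ++ [A] -> G' ++ [A] |-c D' -> G ++ G' |-c D ++ D'
| c_tensor_l G D A B :
    G ++ [A; B] |-c D -> G ++ [CTensor A B] |-c D
| c_tensor_r G G' D D' A B :
    G |-c D ++ [A] -> G' |-c D' ++ [B] ->
    G ++ G' |-c D ++ D' ++ [CTensor A B]
| c_one_l G D :
    G |-c D -> G ++ [COne] |-c D
| c_one_r :
    [] |-c [COne]
| c_par_l G G' D D' A B :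
    G ++ [A] |-c D -> G' ++ [B] |-c D' ->
    G ++ G' ++ [CPar A B] |-c D ++ D'
| c_par_r G D A B :
    G |-c D ++ [A; B] -> G |-c D ++ [CPar A B]
| c_bot_l :
    [CBot] |-c []
| c_bot_r G D :
    G |-c D -> G |-c D ++ [CBot]
| c_neg_l G D A :
    G |-c D ++ [A] -> G ++ [CNeg A] |-c D
| c_neg_r G D A :
    G ++ [A] |-c D -> G |-c D ++ [CNeg A]
| c_lolli_l G G' D D' A B :
    G |-c D ++ [A] -> G' ++ [B] |-c D' ->
    G ++ G' ++ [CLolli A B] |-c D ++ D'
| c_lolli_r G D A B :
    G ++ [A] |-c D ++ [B] -> G |-c D ++ [CLolli A B]
| c_with_l1 G D A B :
    G ++ [A] |-c D -> G ++ [CWith A B] |-c D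
| c_with_l2 G D A B :
    G ++ [B] |-c D -> G ++ [CWith A B] |-c D
| c_with_r G D A B :
    G |-c D ++ [A] -> G |-c D ++ [B] -> G |-c D ++ [CWith A B]
| c_plus_l G D A B :
    G ++ [A] |-c D -> G ++ [B] |-c D -> G ++ [CPlus A B] |-c D
| c_plus_r1 G D A B :
    G |-c D ++ [A] -> G |-c D ++ [CPlus A B]
| c_plus_r2 G D A B :
    G |-c D ++ [B] -> G |-c D ++ [CPlus A B]
where "G |-c D" := (cderiv G D).

(* Sequents have exactly one formula on the right, so each rule is the classical
   one with the right-hand contexts forced: [D := []] wherever the active formula
   is on the right, and a single formula [C] otherwise. *)

Reserved Notation "G |-i C" (at level 70, no associativity).

Inductive ideriv (At : Type) : list (iform At) -> iform At -> Prop :=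
| i_exchange G G' A B C :
    G ++ [A; B] ++ G' |-i C -> G ++ [B; A] ++ G' |-i C
| i_id A :
    [A] |-i A
| i_cut G G' A C :
    G |-i A -> G' ++ [A] |-i C -> G ++ G' |-i C
| i_tensor_l G A B C :
    G ++ [A; B] |-i C -> G ++ [ITensor A B] |-i C
| i_tensor_r G G' A B :
    G |-i A -> G' |-i B -> G ++ G' |-i ITensor A B
| i_one_l G C :
    G |-i C -> G ++ [IOne] |-i C
| i_one_r :
    [] |-i IOne
| i_lolli_l G G' A B C :
    G |-i A -> G' ++ [B] |-i C -> G ++ G' ++ [ILolli A B] |-i C
| i_lolli_r G A B :
    G ++ [A] |-i B -> G |-i ILolli A B
| i_with_l1 G A B C :
    G ++ [A] |-i C -> G ++ [IWith A B] |-i C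
| i_with_l2 G A B C :
    G ++ [B] |-i C -> G ++ [IWith A B] |-i C
| i_with_r G A B :
    G |-i A -> G |-i B -> G |-i IWith A B
| i_plus_l G A B C :
    G ++ [A] |-i C -> G ++ [B] |-i C -> G ++ [IPlus A B] |-i C
| i_plus_r1 G A B :
    G |-i A -> G |-i IPlus A B
| i_plus_r2 G A B :
    G |-i B -> G |-i IPlus A B
where "G |-i C" := (ideriv G C).

(* Main.v *)
Require Import Defs.
From Stdlib Require Import Permutation Morphisms Setoid.

(** The proof is semantic and never eliminates a cut syntactically.  Classical
    linear logic is sound, cut included, in every phase model: a commutative
    monoid with a distinguished subset, the pole, in which a formula denotes a
    set of the form [X^⊥] and a sequent holds when the product of the denotations
    of its hypotheses and of the orthogonals of its conclusions lies in the pole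
    ([soundness]).

    The model chosen here has multisets of formulas marked as hypothesis or as
    conclusion for elements, and its pole consists of the multisets that form a
    derivable _intuitionistic_ sequent; in particular they have exactly one
    conclusion.  As in Okada's proof of cut elimination, one shows by induction
    on an intuitionistic formula [A] that the hypothesis [A] belongs to the
    denotation of [A] and the conclusion [A] to its orthogonal
    ([canonical_ival]).  A classically derivable
    sequent holds in the model; instantiating its denotations by these canonical
    elements says that the sequent itself is in the pole, that is,
    intuitionistically derivable.

    The restriction to one conclusion costs nothing because of what orthogonality
    says about these connectives.  For [A ⊸ B] on the left, say, one has to combine
    an element [x] of the value of [A] with an element [y] orthogonal to that of
    [B].  That [x] together with the conclusion [A] is in the pole forces [x] to
    consist of hypotheses alone, so that the conclusion of the compound sequent
    comes from [y], as the intuitionistic rule demands.  The argument would break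
    down for [⊤] and [0]: every element belongs to the value of [⊤] and is
    orthogonal to that of [0], whatever its number of conclusions. *)

(** * Phase semantics over a free commutative monoid *)

(** Elements of the monoid are lists, to be read up to permutation: every pole
    below is permutation invariant. *)
Section Phase.

Variable S : Type.
Variable pole : list S -> Prop.
Hypothesis pole_perm : Proper (@Permutation S ==> iff) pole.

Definition orth (X : list S -> Prop) : list S -> Prop :=
  fun x => forall a, X a -> pole (a ++ x).

Definition tens (X Y : list S -> Prop) : list S -> Prop :=
  fun x => exists a b, X a /\ Y b /\ x = a ++ b.

Definition union (X Y : list S -> Prop) : list S -> Prop :=
  fun x => X x \/ Y x.

Definition unit_set : list S -> Prop := fun x => x = [].

Definition incl (X Y : list S -> Prop) : Prop := forall x, X x -> Y x.

Lemma orth_anti X Y : incl X Y -> incl (orth Y) (orth X).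
Proof. intros H x Hx a Ha. auto. Qed.

Lemma orth_orth_intro X : incl X (orth (orth X)).
Proof.
  intros x Hx a Ha. rewrite (Permutation_app_comm a x). auto.
Qed.

Lemma orth3 X : incl (orth (orth (orth X))) (orth X).
Proof. apply orth_anti, orth_orth_intro. Qed.

Fixpoint prod (L : list (list S -> Prop)) : list S -> Prop :=
  match L with
  | [] => unit_set
  | X :: L' => tens X (prod L')
  end.

(** A sequent is one-sided here: conclusions enter the list through the
    orthogonals of their values. *)
Definition valid (L : list (list S -> Prop)) : Prop := incl (prod L) pole.

Lemma prod_app L L' x :
  prod (L ++ L') x -> exists a b, prod L a /\ prod L' b /\ x = a ++ b.
Proof.
  revert x. induction L as [|X L IH]; simpl; intros x Hx.
  - exists [], x. repeat split; auto.
  - destruct Hx as (a & b & Ha & Hb & ->).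
    destruct (IH b Hb) as (c & d & Hc & Hd & ->).
    exists (a ++ c), d. rewrite app_assoc. repeat split; auto.
    exists a, c. auto.
Qed.

Lemma prod_perm L L' :
  Permutation L L' ->
  forall x, prod L x -> exists y, prod L' y /\ Permutation x y.
Proof.
  induction 1 as [|X L L' _ IH|X Y L|L1 L2 L3 _ IH1 _ IH2]; simpl; intros x Hx.
  - eauto.
  - destruct Hx as (a & b & Ha & Hb & ->).
    destruct (IH b Hb) as (y & Hy & E).
    exists (a ++ y). split; [exists a, y; auto | now rewrite E].
  - destruct Hx as (a & b & Ha & (c & d & Hc & Hd & ->) & ->).
    exists (c ++ a ++ d). split.
    + exists c, (a ++ d). repeat split; auto. exists a, d. auto.
    + apply Permutation_app_swap_app.
  - destruct (IH1 x Hx) as (y & Hy & E).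
    destruct (IH2 y Hy) as (z & Hz & E').
    exists z. split; auto. now rewrite E.
Qed.

#[local] Instance valid_perm : Proper (@Permutation _ ==> iff) valid.
Proof.
  assert (K : forall L L', Permutation L L' -> valid L -> valid L').
  { intros L L' E H x Hx.
    destruct (prod_perm _ _ (Permutation_sym E) x Hx) as (y & Hy & Exy).
    rewrite Exy. auto. }
  intros L L' E. split; apply K; auto using Permutation_sym.
Qed.

Lemma valid_cons X L : valid (X :: L) <-> incl (prod L) (orth X).
Proof.
  split.
  - intros H x Hx a Ha. apply H. exists a, x. auto.
  - intros H x (a & b & Ha & Hb & ->). apply H; auto.
Qed.

Lemma valid_incl X Y L : incl X Y -> valid (Y :: L) -> valid (X :: L).
Proof.
  rewrite !valid_cons. intros HXY H x Hx. apply (orth_anti _ _ HXY). auto.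
Qed.

(** The orthogonal of a set is that of its biorthogonal closure; so a left rule
    only has to be checked on generators. *)
Lemma valid_closure X L : valid (X :: L) -> valid (orth (orth X) :: L).
Proof.
  rewrite !valid_cons. intros H x Hx. apply orth_orth_intro. auto.
Qed.

Lemma valid_tens X Y L : valid (X :: Y :: L) -> valid (tens X Y :: L).
Proof.
  intros H x (ab & c & (a & b & Ha & Hb & ->) & Hc & ->).
  rewrite <- app_assoc. apply H. exists a, (b ++ c).
  repeat split; auto. exists b, c. auto.
Qed.

Lemma valid_union X Y L :
  valid (X :: L) -> valid (Y :: L) -> valid (union X Y :: L).
Proof.
  rewrite !valid_cons. intros HX HY x Hx a [Ha|Ha].
  - apply HX; auto.
  - apply HY; auto.
Qed.

Lemma valid_unit L : valid L -> valid (unit_set :: L).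
Proof. rewrite valid_cons. intros H x Hx a ->. apply H, Hx. Qed.

Lemma valid_orth_unit : valid [orth unit_set].
Proof.
  apply valid_cons. intros x ->. now apply orth_orth_intro.
Qed.

(** One lemma serves [⊗] on the right and [⅋], [⊸] on the left, which differ only
    in which of the sets involved are orthogonals.  The premises place their
    contexts in [orth U] and [orth V]; the inclusions are then reflexivity or
    biorthogonal closure. *)
Lemma valid_orth_tens U V X Y L L' :
  incl (orth U) X -> incl (orth V) Y ->
  valid (U :: L) -> valid (V :: L') -> valid (orth (tens X Y) :: L ++ L').
Proof.
  rewrite !valid_cons. intros HX HY HU HV x Hx.
  apply orth_orth_intro.
  destruct (prod_app _ _ _ Hx) as (a & b & Ha & Hb & ->).
  exists a, b. auto.
Qed.

Lemma valid_cut X L L' :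
  incl (orth (orth X)) X ->
  valid (orth X :: L) -> valid (X :: L') -> valid (L ++ L').
Proof.
  rewrite !valid_cons. intros HX H H' x Hx.
  destruct (prod_app _ _ _ Hx) as (a & b & Ha & Hb & ->).
  apply (H' b Hb). auto.
Qed.

Lemma valid_id X : valid [X; orth X].
Proof.
  apply valid_cons. intros x (a & b & Ha & -> & ->).
  now rewrite app_nil_r.
Qed.

(** * Soundness of the classical system *)

Variable At : Type.
Variable atom_val : At -> list S -> Prop.

(** Every clause is an orthogonal, which makes every value biorthogonally
    closed; this dictates the form of the clauses for atoms and [&]. *)
Fixpoint val (A : cform At) : list S -> Prop :=
  match A with
  | CAtom a => orth (atom_val a)
  | CNeg A => orth (val A)
  | CTensor A B => orth (orth (tens (val A) (val B)))
  | CPar A B => orth (tens (orth (val A)) (orth (val B)))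
  | COne => orth (orth unit_set)
  | CBot => orth unit_set
  | CLolli A B => orth (tens (val A) (orth (val B)))
  | CWith A B => orth (union (orth (val A)) (orth (val B)))
  | CPlus A B => orth (orth (union (val A) (val B)))
  end.

Lemma val_closed A : incl (orth (orth (val A))) (val A).
Proof. destruct A; apply orth3. Qed.

Definition nval (A : cform At) : list S -> Prop := orth (val A).

Definition sequent_sets (G D : list (cform At)) : list (list S -> Prop) :=
  map val G ++ map nval D.

Lemma sequent_sets_l G D A :
  Permutation (sequent_sets (G ++ [A]) D) (val A :: sequent_sets G D).
Proof.
  unfold sequent_sets. rewrite map_app, <- app_assoc. simpl.
  symmetry. apply Permutation_middle.
Qed.

Lemma sequent_sets_r G D A :
  Permutation (sequent_sets G (D ++ [A])) (nval A :: sequent_sets G D).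
Proof.
  unfold sequent_sets. rewrite map_app, app_assoc. simpl.
  symmetry. apply Permutation_cons_append.
Qed.

Lemma sequent_sets_app G G' D D' :
  Permutation (sequent_sets (G ++ G') (D ++ D'))
              (sequent_sets G D ++ sequent_sets G' D').
Proof.
  unfold sequent_sets. rewrite !map_app, <- !app_assoc.
  apply Permutation_app_head, Permutation_app_swap_app.
Qed.

Lemma sequent_sets_perm G G' D D' :
  Permutation G G' -> Permutation D D' ->
  Permutation (sequent_sets G D) (sequent_sets G' D').
Proof.
  intros EG ED. unfold sequent_sets. now rewrite EG, ED.
Qed.

Lemma snoc2 (T : Type) (l : list T) a b : l ++ [a; b] = (l ++ [a]) ++ [b].
Proof. now rewrite <- app_assoc. Qed.

Lemma perm_exchange (T : Type) (l l' : list T) a b :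
  Permutation (l ++ [a; b] ++ l') (l ++ [b; a] ++ l').
Proof. apply Permutation_app_head, perm_swap. Qed.

Theorem soundness G D : G |-c D -> valid (sequent_sets G D).
Proof.
  induction 1;
    (* exchange keeps its lists; everywhere else the active formulas move to
       the front and the contexts of two premises are separated *)
    try (erewrite sequent_sets_perm;
         [eassumption | apply perm_exchange || reflexivity
                      | apply perm_exchange || reflexivity]);
    rewrite ?snoc2, ?app_assoc in *;
    rewrite ?sequent_sets_l, ?sequent_sets_r, ?sequent_sets_app in *;
    rewrite ?sequent_sets_l, ?sequent_sets_r in *.
  - apply valid_id.
  - apply valid_cut with (X := val A); auto using val_closed.
  - apply valid_closure, valid_tens. now rewrite perm_swap.
  - apply (valid_incl _ _ _ (orth3 _)).
    apply valid_orth_tens with (U := nval A) (V := nval B);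
      assumption || apply val_closed.
  - now apply valid_closure, valid_unit.
  - apply (valid_incl _ _ _ (orth3 _)), valid_orth_unit.
  - apply valid_orth_tens with (U := val A) (V := val B);
      assumption || (intros x Hx; exact Hx).
  - apply valid_closure, valid_tens. now rewrite perm_swap.
  - apply valid_orth_unit.
  - now apply valid_closure, valid_unit.
  - assumption.
  - now apply valid_closure.
  - apply valid_orth_tens with (U := nval A) (V := val B);
      assumption || apply val_closed || (intros x Hx; exact Hx).
  - now apply valid_closure, valid_tens.
  - refine (valid_incl _ _ _ _ IHcderiv).
    intros x Hx. apply val_closed. intros a Ha. apply Hx. now left.
  - refine (valid_incl _ _ _ _ IHcderiv).
    intros x Hx. apply val_closed. intros a Ha. apply Hx. now right.
  - now apply valid_closure, valid_union.
  - now apply valid_closure, valid_union.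
  - apply (valid_incl _ _ _ (orth3 _)).
    refine (valid_incl _ _ _ (orth_anti _ _ _) IHcderiv).
    intros x Hx. now left.
  - apply (valid_incl _ _ _ (orth3 _)).
    refine (valid_incl _ _ _ (orth_anti _ _ _) IHcderiv).
    intros x Hx. now right.
Qed.

(** Soundness, evaluated at one chosen element of each denotation. *)
Lemma soundness_at (I : Type) (f : I -> cform At) (h c : I -> S) G D :
  (forall i, val (f i) [h i]) ->
  (forall i, nval (f i) [c i]) ->
  map f G |-c map f D ->
  pole (map h G ++ map c D).
Proof.
  intros HG HD H. apply soundness in H. apply H. clear H.
  unfold sequent_sets. induction G as [|i G IH]; simpl.
  - induction D as [|i D IH]; simpl; [reflexivity|].
    exists [c i], (map c D). auto.
  - exists [h i], (map h G ++ map c D). auto.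
Qed.

End Phase.

Arguments orth {S} pole X x.
Arguments tens {S} X Y x.
Arguments union {S} X Y x.
Arguments unit_set {S} x.
Arguments val {S} pole {At} atom_val A x.

(** * The phase model of intuitionistic derivability *)

Inductive entry (At : Type) : Type :=
| Hyp (A : iform At)
| Concl (A : iform At).

Arguments Hyp {At} A.
Arguments Concl {At} A.

Definition hyps {At : Type} : list (entry At) -> list (iform At) :=
  flat_map (fun e => match e with Hyp A => [A] | Concl _ => [] end).

Definition concls {At : Type} : list (entry At) -> list (iform At) :=
  flat_map (fun e => match e with Hyp _ => [] | Concl A => [A] end).

Definition ipole {At : Type} (x : list (entry At)) : Prop :=
  exists C, concls x = [C] /\ hyps x |-i C.

Lemma ideriv_perm (At : Type) (G G' : list (iform At)) C :
  Permutation G G' -> G |-i C -> G' |-i C.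
Proof.
  intros E.
  (* a left context makes the induction go through under a cons *)
  enough (K : forall L, L ++ G |-i C -> L ++ G' |-i C) by apply (K []).
  induction E as [|A G G' _ IH|A B G|G1 G2 G3 _ IH1 _ IH2]; intros L H.
  - assumption.
  - specialize (IH (L ++ [A])). rewrite <- !app_assoc in IH. auto.
  - apply (i_exchange L G B A). assumption.
  - auto.
Qed.

Lemma ipole_perm (At : Type) : Proper (@Permutation (entry At) ==> iff) ipole.
Proof.
  assert (K : forall x y : list (entry At), Permutation x y -> ipole x -> ipole y).
  { intros x y E (C & HC & H). exists C. split.
    - apply Permutation_length_1_inv. rewrite <- HC.
      now apply Permutation_flat_map.
    - revert H. apply ideriv_perm. now apply Permutation_flat_map. }
  intros x y E. split; apply K; auto using Permutation_sym.
Qed.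

Lemma concls_app (At : Type) (x y : list (entry At)) :
  concls (x ++ y) = concls x ++ concls y.
Proof. apply flat_map_app. Qed.

Lemma hyps_app (At : Type) (x y : list (entry At)) :
  hyps (x ++ y) = hyps x ++ hyps y.
Proof. apply flat_map_app. Qed.

(** This is where a second conclusion is excluded. *)
Lemma ipole_concl (At : Type) (x : list (entry At)) A :
  ipole (x ++ [Concl A]) <-> concls x = [] /\ hyps x |-i A.
Proof.
  unfold ipole. rewrite concls_app, hyps_app. simpl. rewrite app_nil_r. split.
  - intros (C & HC & H). apply (app_inj_tail (concls x) [] A C) in HC.
    destruct HC as [-> ->]. auto.
  - intros [-> H]. exists A. auto.
Qed.

Lemma ipole_hyp (At : Type) (x : list (entry At)) A :
  ipole (x ++ [Hyp A]) <-> exists C, concls x = [C] /\ hyps x ++ [A] |-i C.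
Proof.
  unfold ipole. rewrite concls_app, hyps_app. simpl. now rewrite app_nil_r.
Qed.

(** What induction on formulas has to carry.  For [X] the value of [A], the first
    half makes the left rules of [A] available to whatever is orthogonal to [X],
    the second says that every element of [X] derives [A]. *)
Definition canonical {At : Type} (X : list (entry At) -> Prop) (A : iform At) :
  Prop := X [Hyp A] /\ orth ipole X [Concl A].

Section Canonical.

Variable At : Type.
Variables (X Y : list (entry At) -> Prop) (A B : iform At).
Hypotheses (HX : canonical X A) (HY : canonical Y B).

Lemma orth_uses (Z : list (entry At) -> Prop) (C : iform At) z :
  canonical Z C -> orth ipole Z z ->
  exists E, concls z = [E] /\ hyps z ++ [C] |-i E.
Proof.
  intros [HC _] Hz. apply ipole_hyp.
  apply (ipole_perm _ _ _ (Permutation_app_comm [Hyp C] z)). auto.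
Qed.

Lemma member_derives (Z : list (entry At) -> Prop) (C : iform At) z :
  canonical Z C -> Z z -> concls z = [] /\ hyps z |-i C.
Proof. intros [_ HC] Hz. apply ipole_concl. auto. Qed.

Lemma canonical_atom a :
  canonical (orth ipole (fun x : list (entry At) => x = [Concl (IAtom a)]))
            (IAtom a).
Proof.
  split.
  - intros x ->. exists (IAtom a). split; [reflexivity | apply i_id].
  - apply orth_orth_intro; [apply ipole_perm | reflexivity].
Qed.

Lemma canonical_tensor :
  canonical (orth ipole (orth ipole (tens X Y))) (ITensor A B).
Proof.
  split.
  - intros z Hz. apply ipole_hyp.
    destruct (Hz [Hyp A; Hyp B]) as (C & HC & D).
    { exists [Hyp A], [Hyp B].
      split; [apply HX | split; [apply HY | reflexivity]]. }
    exists C. split; [exact HC|].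
    apply i_tensor_l.
    exact (ideriv_perm _ _ _ _ (Permutation_app_comm [A; B] (hyps z)) D).
  - apply orth_orth_intro; [apply ipole_perm|].
    intros x (a & b & Ha & Hb & ->). apply ipole_concl.
    destruct (member_derives _ _ _ HX Ha) as [Ea Da].
    destruct (member_derives _ _ _ HY Hb) as [Eb Db].
    rewrite concls_app, hyps_app, Ea, Eb.
    split; [reflexivity | now apply i_tensor_r].
Qed.

Lemma canonical_one :
  canonical (orth ipole (orth ipole (@unit_set (entry At)))) IOne.
Proof.
  split.
  - intros z Hz. apply ipole_hyp.
    destruct (Hz [] eq_refl) as (C & HC & D).
    exists C. split; [exact HC | now apply i_one_l].
  - apply orth_orth_intro; [apply ipole_perm|].
    intros x ->. apply (ipole_concl _ []).
    split; [reflexivity | apply i_one_r].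
Qed.

Lemma canonical_lolli :
  canonical (orth ipole (tens X (orth ipole Y))) (ILolli A B).
Proof.
  split.
  - intros x (a & b & Ha & Hb & ->). apply ipole_hyp.
    destruct (member_derives _ _ _ HX Ha) as [Ea Da].
    destruct (orth_uses _ _ _ HY Hb) as (C & Eb & Db).
    exists C. rewrite concls_app, hyps_app, Ea, Eb, <- app_assoc.
    split; [reflexivity | now apply i_lolli_l].
  - intros z Hz.
    assert (K : ipole ((z ++ [Hyp A]) ++ [Concl B])).
    { rewrite <- app_assoc.
      apply (ipole_perm _ _ _ (Permutation_app_comm [Hyp A; Concl B] z)).
      apply Hz. exists [Hyp A], [Concl B].
      split; [apply HX | split; [apply HY | reflexivity]]. }
    apply ipole_concl in K. rewrite concls_app, hyps_app in K.
    destruct K as [E D]. simpl in E, D. rewrite app_nil_r in E.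
    apply ipole_concl. split; [exact E | now apply i_lolli_r].
Qed.

Lemma canonical_with :
  canonical (orth ipole (union (orth ipole X) (orth ipole Y))) (IWith A B).
Proof.
  split.
  - intros z [Hz|Hz]; apply ipole_hyp.
    + destruct (orth_uses _ _ _ HX Hz) as (C & E & D).
      exists C. split; [exact E | now apply i_with_l1].
    + destruct (orth_uses _ _ _ HY Hz) as (C & E & D).
      exists C. split; [exact E | now apply i_with_l2].
  - intros z Hz. apply ipole_concl.
    assert (KA : ipole (z ++ [Concl A])).
    { apply (ipole_perm _ _ _ (Permutation_app_comm [Concl A] z)).
      apply Hz. left. apply HX. }
    assert (KB : ipole (z ++ [Concl B])).
    { apply (ipole_perm _ _ _ (Permutation_app_comm [Concl B] z)).
      apply Hz. right. apply HY. }
    apply ipole_concl in KA. apply ipole_concl in KB.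
    destruct KA as [E DA]. destruct KB as [_ DB].
    split; [exact E | now apply i_with_r].
Qed.

Lemma canonical_plus :
  canonical (orth ipole (orth ipole (union X Y))) (IPlus A B).
Proof.
  split.
  - intros z Hz. apply ipole_hyp.
    destruct (orth_uses X A z HX) as (C & E & DA).
    { intros a Ha. apply Hz. now left. }
    destruct (orth_uses Y B z HY) as (C' & E' & DB).
    { intros a Ha. apply Hz. now right. }
    (* both premises have the conclusion that [z] carries *)
    rewrite E in E'. injection E' as <-.
    exists C. split; [exact E | now apply i_plus_l].
  - apply orth_orth_intro; [apply ipole_perm|].
    intros z [Hz|Hz]; apply ipole_concl.
    + destruct (member_derives _ _ _ HX Hz) as [E D].
      split; [exact E | now apply i_plus_r1].
    + destruct (member_derives _ _ _ HY Hz) as [E D].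
      split; [exact E | now apply i_plus_r2].
Qed.

End Canonical.

(** An atom denotes the set of contexts that derive it. *)
Definition ival {At : Type} : cform At -> list (entry At) -> Prop :=
  val ipole (fun a x => x = [Concl (IAtom a)]).

Lemma canonical_ival (At : Type) (A : iform At) : canonical (ival (embed A)) A.
Proof.
  induction A as [a|A HA B HB| |A HA B HB|A HA B HB|A HA B HB].
  - apply canonical_atom.
  - now apply canonical_tensor.
  - apply canonical_one.
  - now apply canonical_lolli.
  - now apply canonical_with.
  - now apply canonical_plus.
Qed.

Theorem theorem8p1 (At : Type) (As : list (iform At)) (B : iform At) :
  map (@embed At) As |-c [embed B] -> As |-i B.
Proof.
  intros H.
  assert (K : ipole (map Hyp As ++ [Concl B])).
  { apply (soundness_at _ _ (ipole_perm At) At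
             (fun a x => x = [Concl (IAtom a)]) _ (@embed At) Hyp Concl As [B]);
      [intros A; apply canonical_ival | intros A; apply canonical_ival | exact H]. }
  apply ipole_concl in K. destruct K as [_ K].
  replace As with (hyps (map Hyp As)); [exact K|].
  clear. induction As as [|A As IH]; simpl; congruence.
Qed.
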